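(* Fix $n\ge 0$. The number of $\sigma$-nice forests (respectively, trees) with label set $[n]$ is the same for $\sigma=1234$, $1423$ and $1324$. Furthermore, the number of $\sigma$-extranice forests (respectively, trees) with label set $[n]$ is the same for $\sigma=1234$, $1423$ and $1324$.
   Context: In a rooted tree the root has depth $1$ and every other vertex has depth one more than its parent; in a rooted forest depths are taken within each tree. A consecutive instance of $\sigma\in\mathcal{S}_4$ is a sequence of vertices $v_1,v_2,v_3,v_4$ with $v_i$ the parent of $v_{i+1}$ and labels in the same relative order as $\sigma$; $v_4$ is its endpoint. An unordered rooted forest (resp.\ tree; trees are nonempty) with distinct positive integer labels is $\sigma$-nice if every vertex of odd depth has at least one child, every vertex of even depth has label greater than its parent's, and every vertex of even depth at least $4$ is the endpoint of a consecutive instance of $\sigma$. It is $\sigma$-extranice if it is $\sigma$-nice and every vertex of odd depth has exactly one child. *)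

(* Defs.v *)
From mathcomp Require Import all_boot.
Set Implicit Arguments.
Unset Strict Implicit.
Unset Printing Implicit Defensive.

(* An unordered rooted forest with label set [n] is identified with its parent
   map on 'I_n: the vertex i : 'I_n carries the label i + 1 (only the relative
   order of labels is ever used), and the roots are the vertices mapped to
   None. Parent maps with cycles are excluded by is_forest. *)
Definition parent_map (n : nat) := {ffun 'I_n -> option 'I_n}.

Section Forests.

Variable n : nat.
Implicit Types (f : parent_map n) (v w : 'I_n).

Definition ancestor f (k : nat) v : option 'I_n :=
  iter k (obind f) (Some v).

(* The bound k <= n loses nothing: see is_forestP. *)
Definition is_forest f : bool :=
  [forall v, [exists k : 'I_n.+1, ancestor f k v == None]].

Definition is_root f v : bool := f v == None.

Definition is_tree f : bool :=
  is_forest f && (#|[set v | is_root f v]| == 1).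

Definition children f v : {set 'I_n} := [set w | f w == Some v].

(* The least k such that v has no k-th ancestor, so that roots have depth 1. *)
Definition depth f v : nat :=
  find (fun k => ancestor f k v == None) (iota 0 n.+1).

(* sigma is in one-line notation. *)
Definition consecutive_instance (sigma : 4.-tuple nat) f (v : 4.-tuple 'I_n)
    : bool :=
  sorted (fun x y => f y == Some x) v &&
  [forall i, forall j,
     (tnth v i < tnth v j) == (tnth sigma i < tnth sigma j)].

Definition is_endpoint (sigma : 4.-tuple nat) f w : bool :=
  [exists v : 4.-tuple 'I_n,
     consecutive_instance sigma f v && (tnth v ord_max == w)].

Definition nice (sigma : 4.-tuple nat) f : bool :=
  [&& [forall v, odd (depth f v) ==> (0 < #|children f v|)],
      [forall v, ~~ odd (depth f v) ==>
         [forall u, (f v == Some u) ==> (u < v)]]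
    & [forall v, ~~ odd (depth f v) && (4 <= depth f v) ==>
         is_endpoint sigma f v]].

Definition extranice (sigma : 4.-tuple nat) f : bool :=
  nice sigma f && [forall v, odd (depth f v) ==> (#|children f v| == 1)].

Lemma ancestorS f k v : ancestor f k.+1 v = obind (ancestor f k) (f v).
Proof.
rewrite /ancestor iterSr /=; case: (f v) => //=.
by elim: k => //= k ->.
Qed.

Lemma ancestor_None f j k v :
  j <= k -> ancestor f j v = None -> ancestor f k v = None.
Proof.
move=> /subnK <- h; rewrite /ancestor iterD -/(ancestor f j v) h.
by elim: (k - j) => //= m ->.
Qed.

Lemma is_forestP f :
  reflect (forall v, exists k, ancestor f k v = None) (is_forest f).
Proof.
apply: (iffP forallP) => [h v|h v].
  by have /existsP[k /eqP hk] := h v; exists k.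
apply/existsP; exists ord_max; apply/eqP => /=.
case E: (ancestor f n v) => [w|//]; exfalso.
have dec k : k <= n -> ancestor f k v != None.
  by move=> kn; apply/eqP => /(ancestor_None kn); rewrite E.
pose g (k : 'I_n.+1) := odflt v (ancestor f k v).
have gE (k : 'I_n.+1) : ancestor f k v = Some (g k).
  have := dec k (ltn_ord k); rewrite /g.
  by case: (ancestor f k v).
have /injectivePn[i [j ij gij]] : ~~ injectiveb g.
  apply/negP => /injectiveP /leq_card; by rewrite !card_ord ltnn.
wlog lij : i j ij gij / i < j.
  move=> H; case: (ltngtP i j) => [l|l|/val_inj e].
  - exact: (H i j).
  - by apply: (H j i) => //; rewrite eq_sym.
  - by rewrite e eqxx in ij.
have aij : ancestor f i v = ancestor f j v by rewrite !gE gij.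
have per m : ancestor f (m + i) v = ancestor f (m + j) v.
  by rewrite /ancestor !iterD -/(ancestor f i v) -/(ancestor f j v) aij.
have all k : ancestor f k v != None.
  elim/ltn_ind: k => k IH; case: (leqP k n) => [/dec //|nk].
  have jk : j <= k by apply: ltnW; apply: leq_ltn_trans nk; rewrite -ltnS.
  rewrite -(subnK jk) -per; apply: IH.
  by rewrite -{2}(subnK jk) ltn_add2l.
by have [k hk] := h v; have := all k; rewrite hk.
Qed.

Lemma depth_le f k v : k <= n -> ancestor f k v = None -> depth f v <= k.
Proof.
move=> kn hk; rewrite leqNgt; apply/negP => lt.
by have := before_find 0 lt; rewrite nth_iota ?ltnS // add0n hk eqxx.
Qed.

Lemma depth_spec f v : is_forest f ->
  [/\ depth f v <= n, ancestor f (depth f v) v = None &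
      forall k, k < depth f v -> ancestor f k v <> None].
Proof.
move=> /forallP/(_ v)/existsP[k0 /eqP hk0].
have dn : depth f v <= n.
  by apply: leq_trans (depth_le _ hk0) _; rewrite -ltnS ltn_ord.
split=> //.
  have hs : has (fun k => ancestor f k v == None) (iota 0 n.+1).
    by rewrite has_find size_iota ltnS.
  by have /eqP := nth_find 0 hs; rewrite nth_iota ?add0n // ltnS.
move=> k lt; have := before_find 0 lt.
rewrite nth_iota ?add0n; first by move=> /eqP.
by apply: leq_trans lt _; apply: leq_trans dn _.
Qed.

Lemma depth_root f v : is_root f v -> depth f v = 1.
Proof.
move=> /eqP r; have n0 : 0 < n by apply: leq_ltn_trans (ltn_ord v).
have -> : depth f v =
    find (fun k => ancestor f k v == None) [:: 0, 1 & iota 2 n.-1].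
  by rewrite /depth /= -[in iota 1 n](prednK n0).
by rewrite /= r.
Qed.

Lemma depth_child f u v : is_forest f -> f v = Some u ->
  depth f v = (depth f u).+1.
Proof.
move=> F fv; have [nv av bv] := depth_spec v F.
have [nu au bu] := depth_spec u F.
have aS k : ancestor f k.+1 v = ancestor f k u by rewrite ancestorS fv.
apply/eqP; rewrite eqn_leq; apply/andP; split; rewrite leqNgt; apply/negP => l.
  by apply: (bv _ l); rewrite aS.
case E: (depth f v) av l => [|d] // av l.
by apply: (bu d) => //; rewrite -aS.
Qed.

End Forests.

Definition nice_forests n (sigma : 4.-tuple nat) : {set parent_map n} :=
  [set f | is_forest f && nice sigma f].

Definition nice_trees n (sigma : 4.-tuple nat) : {set parent_map n} :=
  [set f | is_tree f && nice sigma f].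

Definition extranice_forests n (sigma : 4.-tuple nat) : {set parent_map n} :=
  [set f | is_forest f && extranice sigma f].

Definition extranice_trees n (sigma : 4.-tuple nat) : {set parent_map n} :=
  [set f | is_tree f && extranice sigma f].

Definition p1234 : 4.-tuple nat := [tuple 1; 2; 3; 4].
Definition p1423 : 4.-tuple nat := [tuple 1; 4; 2; 3].
Definition p1324 : 4.-tuple nat := [tuple 1; 3; 2; 4].

(* Main.v *)
Require Import Defs.
From mathcomp Require Import all_boot zify.

(* Along a path u, v, u', v' starting at odd depth, the conditions say u < v,
   u < u', u' < v', together with v < u' (for 1234), v > u' and v < v' (for
   1324), or v > u' and v > v' (for 1423).  Color the vertices of even depth
   and forget the depth: in a colored forest the roots may have either color,
   and the conditions become local.  Deleting the vertex with the smallest label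
   then yields a recursion for the polynomials p_n(x, y) counting colored
   forests with x marking the uncolored roots and y the colored ones.  With
   D = d/dy, A = sum_(k allowed) D^k/k! and
   B = 1 + sum_(k allowed) D^(k+1)/(k+1)!, where k is an allowed number of
   children of an uncolored vertex, it reads p_(n+1) = (x A + y B) p_n for 1324
   and 1423, and p_(n+1) = (x A + y S) p_n for 1234, where
   S p(x, y) = p(x + 1, y).  As [S - B, x A + y B] = A (S - B) and
   (S - B) 1 = 0, one has S p_n = B p_n for all n, so the two recursions produce
   the same polynomials.  Nice forests are the colored forests without colored
   root, that is, the part y = 0. *)

Set Implicit Arguments.
Unset Strict Implicit.
Unset Printing Implicit Defensive.

(** * Orders of either direction and binomial convolutions *)

(** The three patterns differ in only two comparisons, whose directions become boolean
    parameters. *)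
Definition cmp (b : bool) (x y : nat) : bool := if b then x < y else y < x.

Lemma cmpSS b x y : cmp b x.+1 y.+1 = cmp b x y.
Proof. by case: b. Qed.

Lemma cmpxx b x : cmp b x x = false.
Proof. by case: b; rewrite /cmp ltnn. Qed.

(* The sum over the subsets S of an e-set of a #|S| * g (e - #|S|); this is the
   transpose of the operator sum_k a(k) D^k/k! of the header. *)
Fixpoint binconv (a g : nat -> nat) (e : nat) : nat :=
  if e is e'.+1 then
    binconv a (fun j => g j.+1) e' + binconv (fun k => a k.+1) g e'
  else a 0 * g 0.

Lemma eq_binconv a g h e : g =1 h -> binconv a g e = binconv a h e.
Proof.
elim: e a g h => [|e IH] a g h gh /=; first by rewrite gh.
by rewrite (IH _ _ h gh) (IH _ _ (fun j => h j.+1)).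
Qed.

Lemma binconvD a g h e :
  binconv a (fun j => g j + h j) e = binconv a g e + binconv a h e.
Proof.
elim: e a g h => [|e IH] a g h /=; first by rewrite mulnDr.
by rewrite !IH addnACA.
Qed.

Lemma binconvZ a m g e : binconv a (fun j => m * g j) e = m * binconv a g e.
Proof.
elim: e a g => [|e IH] a g /=; first by rewrite mulnCA.
by rewrite !IH mulnDr.
Qed.

(** Power series in the same derivative D commute, hence so do their transposes. *)
Lemma binconvC a b g e :
  binconv a (binconv b g) e = binconv b (binconv a g) e.
Proof.
elim: e a b g => [|e IH] a b g /=; first by rewrite mulnCA.
rewrite !binconvD (IH a b) (IH (fun k => a k.+1)) (IH a (fun k => b k.+1)); lia.
Qed.

(** The two convolutions act on different variables, so they commute. *)
Lemma binconv_exchange a b (w : nat -> nat -> nat) t e :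
  binconv a (fun j => binconv b (w^~ j) t) e =
  binconv b (fun i => binconv a (w i) e) t.
Proof.
elim: e a w => [|e IH] a w /=; first by rewrite binconvZ.
by rewrite binconvD (IH a (fun i j => w i j.+1)) IH.
Qed.

(** Fix an element of [E]: the subsets avoiding it and those containing it give the two summands in
    the recursion of [binconv]. *)
Lemma sum_subset_binconv (T : finType) (a g : nat -> nat) (E : {set T}) :
  \sum_(S : {set T} | S \subset E) a #|S| * g #|E :\: S| = binconv a g #|E|.
Proof.
move: {2}#|E| (erefl #|E|) => e cE; rewrite cE.
elim: e a g E cE => [|e IH] a g E cE /=.
  have -> : E = set0 by apply/eqP; rewrite -cards_eq0 cE.
  rewrite (big_pred1 set0); first by rewrite cards0 setD0 cards0.
  by move=> S; rewrite subset0.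
have [x xE] : exists x, x \in E by apply/set0Pn; rewrite -cards_eq0 cE.
have cE' : #|E :\ x| = e by rewrite (cardsD1 x E) xE in cE; lia.
rewrite (bigID (fun S : {set T} => x \in S)) /= addnC; congr (_ + _).
  rewrite -(IH _ _ _ cE'); apply: eq_big => [S|S /andP[sSE nxS]].
    by rewrite subsetD1.
  congr (_ * g _); rewrite (cardsD1 x (E :\: S)) !inE nxS xE add1n; congr _.+1.
  by congr #|pred_of_set _|; apply/setP => y; rewrite !inE andbCA.
rewrite -(IH _ _ _ cE') (reindex_onto (fun S => x |: S) (fun S => S :\ x)) /=.
  apply: eq_big => [S|S].
    rewrite !inE eqxx andbT subsetD1 subUset sub1set xE /=.
    case: (boolP (x \in S)) => xS; last by rewrite setU1K ?eqxx ?andbT.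
    rewrite andbF; apply/negbTE; rewrite negb_and orbC.
    by apply/orP; left; apply/eqP => /setP/(_ x); rewrite !inE eqxx xS.
  rewrite subUset => /andP[_ /eqP eS].
  have nxS : x \notin S by rewrite -eS !inE eqxx.
  rewrite cardsU1 nxS; congr (_ * g _).
  by congr #|pred_of_set _|; apply/setP => y; rewrite !inE negb_or andbCA andbA.
by move=> S /andP[_ xS]; rewrite setD1K.
Qed.

(** * Colored forests and their smallest vertex *)

(* The set consists of the vertices playing the role of even depth. *)
Definition colored_map n := (parent_map n * {set 'I_n})%type.

(** The letters o and e stand for odd and even depth. *)
Definition oroots n (s : colored_map n) :=
  [set v | (s.1 v == None) && (v \notin s.2)].
Definition eroots n (s : colored_map n) :=
  [set v | (s.1 v == None) && (v \in s.2)].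

(* Adds a new smallest vertex ord0, which is colored iff b, has parent p, and
   takes over the roots in S as children. *)
Definition glue n (s : colored_map n) (b : bool) (p : option 'I_n)
    (S : {set 'I_n}) : colored_map n.+1 :=
  ([ffun i => if unlift ord0 i is Some j then
                if j \in S then Some ord0 else omap (lift ord0) (s.1 j)
              else omap (lift ord0) p],
   [set i | if unlift ord0 i is Some j then j \in s.2 else b]).

(** Deletes [ord0]; its children become roots, because [unlift ord0] sends [ord0] to [None]. *)
Definition unglue n (s : colored_map n.+1)
    : colored_map n * (bool * option 'I_n * {set 'I_n}) :=
  (([ffun i => obind (unlift ord0) (s.1 (lift ord0 i))],
    [set i | lift ord0 i \in s.2]),
   (ord0 \in s.2, obind (unlift ord0) (s.1 ord0),
    [set i | s.1 (lift ord0 i) == Some ord0])).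

Section Glue.
Variables (n : nat) (s : colored_map n).
Variables (b : bool) (p : option 'I_n) (S : {set 'I_n}).
Let g := glue s b p S.

Lemma glue0 : g.1 ord0 = omap (lift ord0) p.
Proof. by rewrite ffunE unlift_none. Qed.

Lemma glue_lift i :
  g.1 (lift ord0 i) = if i \in S then Some ord0 else omap (lift ord0) (s.1 i).
Proof. by rewrite ffunE liftK. Qed.

Lemma mem_glue0 : (ord0 \in g.2) = b.
Proof. by rewrite inE unlift_none. Qed.

Lemma mem_glue_lift i : (lift ord0 i \in g.2) = (i \in s.2).
Proof. by rewrite inE liftK. Qed.

Lemma omap_lift_eq (x : option 'I_n) i :
  (omap (lift ord0) x == Some (lift ord0 i)) = (x == Some i).
Proof. by case: x => //= j; rewrite !(inj_eq Some_inj) (inj_eq lift_inj). Qed.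

Lemma omap_lift_eq0 (x : option 'I_n) :
  (omap (lift ord0) x == Some ord0) = false.
Proof.
by case: x => //= j; rewrite (inj_eq Some_inj) eq_sym (negbTE (neq_lift _ _)).
Qed.

Lemma card_lift0 (A : {set 'I_n.+1}) :
  #|A| = (ord0 \in A) + #|[set i | lift ord0 i \in A]|.
Proof.
rewrite -sum1_card big_mkcond big_ord_recl /=; congr (_ + _).
by rewrite -big_mkcond /= sum1dep_card.
Qed.

Lemma card_oroots_glue :
  #|oroots g| = (~~ b && (p == None)) + #|oroots s :\: S|.
Proof.
rewrite card_lift0; congr (_ + _).
  by rewrite inE glue0 mem_glue0 andbC; case: p.
apply: eq_card => i; rewrite !inE /= liftK glue_lift.
by case: (i \in S) => //=; case: (s.1 i).
Qed.

Lemma card_eroots_glue :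
  #|eroots g| = (b && (p == None)) + #|eroots s :\: S|.
Proof.
rewrite card_lift0; congr (_ + _).
  by rewrite inE glue0 mem_glue0 andbC; case: p.
apply: eq_card => i; rewrite !inE /= liftK glue_lift.
by case: (i \in S) => //=; case: (s.1 i).
Qed.

Lemma card_children_glue0 : #|children g.1 ord0| = #|S|.
Proof.
rewrite card_lift0 inE glue0 omap_lift_eq0 add0n.
apply: eq_card => i; rewrite !inE glue_lift.
by case: (i \in S) => //=; rewrite omap_lift_eq0.
Qed.

Hypothesis rootsS : forall i, i \in S -> s.1 i = None.

Lemma card_children_glue_lift u :
  #|children g.1 (lift ord0 u)| = (p == Some u) + #|children s.1 u|.
Proof.
rewrite card_lift0; congr (_ + _).
  by rewrite inE glue0 omap_lift_eq.
apply: eq_card => i; rewrite !inE glue_lift.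
by case: (boolP (i \in S)) => [/rootsS ->|_] //; rewrite omap_lift_eq.
Qed.

(** [glue] overwrites the parents of the members of [S]; since these are roots, no information is
    lost. *)
Lemma glueK : unglue g = (s, (b, p, S)).
Proof.
rewrite /unglue mem_glue0 glue0 [in RHS](surjective_pairing s).
congr ((_, _), (_, _, _)).
- apply/ffunP => i; rewrite ffunE glue_lift.
  case: (boolP (i \in S)) => [/rootsS ->|_] /=; first by rewrite unlift_none.
  by case: (s.1 i) => //= j; rewrite liftK.
- by apply/setP => i; rewrite inE mem_glue_lift.
- by case: p => //= j; rewrite liftK.
- apply/setP => i; rewrite inE glue_lift.
  by case: (i \in S); rewrite ?eqxx ?omap_lift_eq0.
Qed.

End Glue.

(** The hypothesis rules out a self-loop at [ord0], which [unglue] does not distinguish from a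
    root. *)
Lemma unglueK n (s : colored_map n.+1) :
  s.1 ord0 != Some ord0 ->
  let x := unglue s in glue x.1 x.2.1.1 x.2.1.2 x.2.2 = s.
Proof.
case: s => f c /= f0; rewrite /glue; congr (_, _).
  apply/ffunP => i; rewrite ffunE; case: unliftP => [j ->|->].
    rewrite inE ffunE; case: eqP => [-> //|].
    case: (f _) => //= k; case: (unliftP ord0 k) => [l -> //|-> h].
    by case: h.
  case: (f ord0) f0 => //= k; case: (unliftP ord0 k) => [l -> //|->].
  by rewrite eqxx.
apply/setP => i; rewrite !inE; case: unliftP => [j ->|-> //].
by rewrite inE.
Qed.

(** * Local conditions under deletion of the smallest vertex *)

Section Colored.

Variables (q r : bool) (ok : pred nat).

(* In the notation of the header, cmp q orders v and u', cmp r orders v and v'.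
   Acyclicity is not required: it follows from the last condition, by which an
   uncolored vertex has a larger label than its grandparent. *)
Definition locally_nice n (s : colored_map n) : bool :=
  [&& [forall v, (v \notin s.2) ==> ok #|children s.1 v|],
      [forall v, forall u, (s.1 v == Some u) ==>
         ((v \in s.2) == (u \notin s.2)) &&
         (if v \in s.2 then u < v else cmp q u v)]
    & [forall v, forall u, forall w, (s.1 v == Some u) && (s.1 u == Some w) ==>
         (if v \in s.2 then cmp r w v else w < v)]].

Lemma locally_niceP n (s : colored_map n) :
  reflect [/\ forall v, v \notin s.2 -> ok #|children s.1 v|,
              forall v u, s.1 v = Some u ->
                (v \in s.2) = (u \notin s.2) /\
                (if v \in s.2 then u < v else cmp q u v)
            & forall v u w, s.1 v = Some u -> s.1 u = Some w ->
                (if v \in s.2 then cmp r w v else w < v : bool)]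
          (locally_nice s).
Proof.
apply: (iffP and3P) => [[h1 h2 h3]|[h1 h2 h3]]; split.
- by move=> v nv; have /forallP/(_ v)/implyP/(_ nv) := h1.
- move=> v u /eqP e; have /forallP/(_ v)/forallP/(_ u)/implyP/(_ e) := h2.
  by case/andP => /eqP.
- move=> v u w /eqP e1 /eqP e2; move: h3.
  by move=> /forallP/(_ v)/forallP/(_ u)/forallP/(_ w); rewrite e1 e2.
- by apply/forallP => v; apply/implyP; apply: h1.
- apply/forallP => v; apply/forallP => u; apply/implyP => /eqP /h2 [h h'].
  by rewrite h' h eqxx.
- apply/forallP => v; apply/forallP => u; apply/forallP => w.
  by apply/implyP => /andP[/eqP e1 /eqP e2]; apply: h3 e2.
Qed.

(** A colored [ord0] cannot exceed a parent, so it is a root, and it may have children only if [q]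
    lets them be larger. An uncolored [ord0] can lie below a colored [v] only if [q] is false; [v]
    is then a root, as [ord0] exceeds no grandparent, and [cmp r] compares [v] with its new
    grandchildren. *)
Definition glueable n (s : colored_map n)
    (x : bool * option 'I_n * {set 'I_n}) : bool :=
  let: (b, p, A) := x in
  if b then [&& p == None, A \subset oroots s & q || (A == set0)]
  else [&& A \subset eroots s, ok #|A|
         & if p is Some v then
             [&& ~~ q, v \in eroots s & [forall i in A, cmp r v i]]
           else true].

Lemma glueable_root n (s : colored_map n) b p S :
  glueable s (b, p, S) -> forall i, i \in S -> s.1 i = None.
Proof.
move=> h i iS; have : (i \in oroots s) || (i \in eroots s).
  by case: b h => [/and3P[_ /subsetP/(_ i iS) ->] //|];
     move=> /andP[/subsetP/(_ i iS) ->];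
     rewrite orbT.
by rewrite !inE -andb_orr => /andP[/eqP].
Qed.

Lemma unglue_root n (s : colored_map n.+1) i :
  i \in (unglue s).2.2 -> (unglue s).1.1 i = None.
Proof. by rewrite inE ffunE => /eqP -> /=; rewrite unlift_none. Qed.

Hypothesis qr : q ==> r.

(** Lifting preserves comparisons, so only conditions involving [ord0] are new. The child counts of
    the old uncolored vertices do not change, since the parent of [ord0], if any, is colored. *)
Lemma locally_nice_glue n (s : colored_map n) b p (S : {set 'I_n}) :
  (forall i, i \in S -> s.1 i = None) ->
  locally_nice (glue s b p S) = locally_nice s && glueable s (b, p, S).
Proof.
move=> rS.
have gl v u : s.1 v = Some u ->
    (glue s b p S).1 (lift ord0 v) = Some (lift ord0 u).
  move=> e; rewrite glue_lift e; case: (boolP (v \in S)) => // /rS.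
  by rewrite e.
have g0 u : p = Some u -> (glue s b p S).1 ord0 = Some (lift ord0 u).
  by move=> e; rewrite glue0 e.
have gS i : i \in S -> (glue s b p S).1 (lift ord0 i) = Some ord0.
  by move=> e; rewrite glue_lift e.
have c0 := @mem_glue0 n s b p S; have cl := @mem_glue_lift n s b p S.
apply/idP/andP.
- move=> /locally_niceP[h1 h2 h3].
  have hp u : p = Some u -> [/\ b = false, u \in s.2 & ~~ q].
    move=> /g0 /h2; rewrite c0 cl lift0.
    by case: (b) => -[] // /esym/negbFE ->; case: (q).
  split.
    apply/locally_niceP; split.
    + move=> v nv; have := h1 (lift ord0 v); rewrite cl => /(_ nv).
      rewrite card_children_glue_lift //; case: eqP => [/hp[_]|_ //].
      by rewrite (negbTE nv).
    + by move=> v u /gl /h2; rewrite !cl !lift0 cmpSS.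
    + by move=> v u w /gl e1 /gl e2; have := h3 _ _ _ e1 e2;
         rewrite !cl !lift0 cmpSS.
  have hS i : i \in S -> (i \in s.2) = ~~ b /\ ((i \in s.2) || q).
    move=> /gS /h2; rewrite c0 cl lift0 => -[-> h]; split=> //.
    by move: h; case: (b) => //=; case: (q).
  rewrite /glueable; case E: b hp hS => hp hS.
    apply/and3P; split.
    + by apply/eqP; case Ep: (p) => [u|//]; have [] := hp _ Ep.
    + by apply/subsetP => i iS; rewrite inE rS //= (hS i iS).1.
    + case: (set_0Vmem S) => [->|[i iS]]; first by rewrite eqxx orbT.
      by have [-> ] := hS i iS => /= ->.
  apply/and3P; split.
  + by apply/subsetP => i iS; rewrite inE rS //= (hS i iS).1.
  + by have := h1 ord0; rewrite card_children_glue0 c0 E; apply.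
  + case Ep: p hp => [x|//] /(_ _ erefl)[_ xc nq]; rewrite nq inE xc andbT /=.
    apply/andP; split.
      case Ex: (s.1 x) => [w|//].
      by have := h3 _ _ _ (g0 _ Ep) (gl _ _ Ex); rewrite c0 E.
    apply/forall_inP => i iS; have := h3 _ _ _ (gS _ iS) (g0 _ Ep).
    by rewrite cl (hS i iS).1 !lift0 cmpSS.
- case=> /locally_niceP[h1 h2 h3] hg.
  have hS i : i \in S -> (i \in s.2) = ~~ b.
    move=> iS; move: hg; rewrite /glueable.
    case: (b) => /andP[]; last first.
      by move=> /subsetP/(_ i iS); rewrite inE => /andP[].
    move=> _ /andP[/subsetP/(_ i iS)]; rewrite inE => /andP[_ /negbTE] //.
  have hq : b -> S != set0 -> q.
    by move=> eb; move: hg; rewrite /glueable eb => /and3P[_ _ /orP[->|->]].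
  have hp x : p = Some x ->
      [/\ b = false, ~~ q, s.1 x = None, x \in s.2
        & [forall i in S, cmp r x i]].
    move=> ep; move: hg; rewrite /glueable ep; case: (b) => // /and3P[_ _].
    by rewrite inE => /and3P[-> /andP[/eqP -> ->] ->].
  apply/locally_niceP; split.
  + move=> v; case: (unliftP ord0 v) => [u ->|->].
      rewrite cl => nu; rewrite card_children_glue_lift //.
      case: eqP => [/hp[_ _ _]|_]; first by rewrite (negbTE nu).
      exact: h1.
    rewrite c0 card_children_glue0 => nb; move: hg; rewrite /glueable.
    by rewrite (negbTE nb) => /and3P[].
  + move=> v u; case: (unliftP ord0 v) => [v' ->|->].
      rewrite cl glue_lift; case: ifP => [v'S [<-]|_].
        rewrite c0 (hS v' v'S); split => //.
        case: (boolP b) => [/hq hb|_]; rewrite lift0 // /cmp hb //.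
        by apply/set0Pn; exists v'.
      case Ev: (s.1 v') => [u'|//] [<-]; rewrite cl !lift0 cmpSS; exact: h2.
    rewrite c0 glue0; case Ep: p => [x|//] [<-].
    have [eb nq _ xc _] := hp _ Ep.
    by rewrite cl eb xc lift0 /cmp (negbTE nq).
  + move=> v u w; case: (unliftP ord0 v) => [v' ->|->].
      rewrite cl glue_lift; case: ifP => [v'S [<-]|_].
        rewrite glue0 (hS v' v'S); case Ep: p => [x|//] [<-].
        have [-> _ _ _ /forall_inP/(_ v' v'S)] := hp _ Ep.
        by rewrite !lift0 cmpSS.
      case Ev: (s.1 v') => [u'|//] [<-]; rewrite glue_lift.
      case: ifP => [u'S [<-]|_].
        (* If [ord0] is colored, [v'] becomes its colored grandchild, which requires [r]; this
           follows from [q], which holds because [S] contains [u']. *)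
        rewrite lift0; have [-> _] := h2 _ _ Ev; rewrite (hS _ u'S) negbK.
        case: (boolP b) => // /hq hb; move: qr; rewrite hb ?implyTb => [->|] //.
        by apply/set0Pn; exists u'.
      case Eu: (s.1 u') => [w'|//] [<-]; rewrite !lift0 cmpSS; exact: h3 Eu.
    rewrite glue0; case Ep: p => [x|//] [<-]; rewrite glue_lift.
    have [eb _ -> _ /forall_inP hx] := hp _ Ep.
    by case: ifP => // /hx; rewrite cmpxx.
Qed.

(* For w t e = x^t y^e this is the polynomial p_n of the header; the operators
   on polynomials appear as their transposes acting on w. *)
Definition total_weight n (w : nat -> nat -> nat) : nat :=
  \sum_(s : colored_map n | locally_nice s) w #|oroots s| #|eroots s|.

Lemma total_weight_glue n w :
  total_weight n.+1 w =
  \sum_(s : colored_map n | locally_nice s) \sum_(x | glueable s x)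
     w ((~~ x.1.1 && (x.1.2 == None)) + #|oroots s :\: x.2|)
       ((x.1.1 && (x.1.2 == None)) + #|eroots s :\: x.2|).
Proof.
rewrite pair_big_dep /= /total_weight.
rewrite (reindex_onto (fun y => glue y.1 y.2.1.1 y.2.1.2 y.2.2) (@unglue n)) /=.
  apply: eq_big => [[s [[b p] S]]|[s [[b p] S]] _] /=; last first.
    by rewrite card_oroots_glue card_eroots_glue.
  apply/andP/andP => [[h1 /eqP h2]|[h1 h2]].
    have rS i : i \in S -> s.1 i = None.
      by move=> iS; have := @unglue_root n (glue s b p S) i; rewrite h2; apply.
    by move: h1; rewrite locally_nice_glue // => /andP.
  have rS := glueable_root h2.
  by split; [rewrite locally_nice_glue // h1 | rewrite glueK].
(* A self-loop at [ord0] is impossible, as a vertex and its parent differ in color. *)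
move=> s /locally_niceP[_ h2 _]; apply: unglueK; apply/eqP => /h2[].
by case: (ord0 \in s.2).
Qed.

End Colored.

(** * The recursions and their equivalence *)

(** Used to recover the parent of [ord0] from the set formed by it and the children of [ord0]. *)
Lemma cmp_least b n (A : {set 'I_n}) :
  A != set0 -> exists2 v, v \in A & [forall i in A :\ v, cmp b v i].
Proof.
case/set0Pn => x xA; case: b.
  case: (arg_minnP (fun i : 'I_n => i : nat) xA) => v vA hv; exists v => //.
  apply/forall_inP => i /setD1P[ni /hv]; rewrite /cmp leq_eqVlt.
  by rewrite eq_sym (inj_eq val_inj) (negbTE ni).
case: (arg_maxnP (fun i : 'I_n => i : nat) xA) => v vA hv; exists v => //.
apply/forall_inP => i /setD1P[ni /hv]; rewrite /cmp /geq /= leq_eqVlt.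
by rewrite (inj_eq val_inj) (negbTE ni).
Qed.

Lemma cmp_least_uniq b n (A : {set 'I_n}) u v :
  u \in A -> v \in A ->
  [forall i in A :\ u, cmp b u i] -> [forall i in A :\ v, cmp b v i] -> u = v.
Proof.
move=> uA vA /forall_inP hu /forall_inP hv; apply/eqP/negPn/negP => uv.
have := hv u; rewrite !inE uv => /(_ uA); have := hu v.
by rewrite !inE eq_sym uv => /(_ vA); case: b {hu hv} => /=; lia.
Qed.

Section Steps.

Variable ok : pred nat.

Lemma sum_subset_ok (T : finType) (P : pred nat) g (E : {set T}) :
  \sum_(A : {set T} | (A \subset E) && P #|A|) g #|E :\: A|
  = binconv P g #|E|.
Proof.
rewrite -sum_subset_binconv big_mkcondr; apply: eq_bigr => A _.
by case: (P _); rewrite ?mul1n ?mul0n.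
Qed.

(** The coefficients of B: the shift by one accounts for the parent of [ord0], and the value at 0 is
    the term 1. *)
Definition ok_or_0 : pred nat := fun k => if k is j.+1 then ok j else true.

Lemma oroots_eroots n (s : colored_map n) (A : {set 'I_n}) :
  A \subset eroots s -> oroots s :\: A = oroots s.
Proof.
move=> /subsetP AE; apply/setP => i; rewrite !inE.
case: (boolP (i \in A)) => //= /AE; rewrite inE => /andP[_ ->].
by rewrite andbF.
Qed.

Lemma eroots_oroots n (s : colored_map n) (A : {set 'I_n}) :
  A \subset oroots s -> eroots s :\: A = eroots s.
Proof.
move=> /subsetP AE; apply/setP => i; rewrite !inE.
case: (boolP (i \in A)) => //= /AE; rewrite inE => /andP[_ /negbTE->].
by rewrite andbF.
Qed.

(** This is the term x A: when [ord0] is an uncolored root, the only choice is the set of its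
    children. *)
Lemma sum_glue_oroot q r n (s : colored_map n) w :
  \sum_(x | glueable q r ok s x && (~~ x.1.1 && (x.1.2 == None)))
     w ((~~ x.1.1 && (x.1.2 == None)) + #|oroots s :\: x.2|)
       ((x.1.1 && (x.1.2 == None)) + #|eroots s :\: x.2|)
  = binconv ok (w #|oroots s|.+1) #|eroots s|.
Proof.
rewrite (reindex_onto (fun A => (false, None, A)) snd) /=; last first.
  by case=> [[b p] A] /= /andP[_ /andP[/negbTE -> /eqP ->]].
rewrite -sum_subset_ok; apply: eq_big => [A|A].
  by rewrite !andbT eqxx andbT.
by case/andP => /andP[/and3P[/oroots_eroots -> _ _] _] _.
Qed.

(** Besides x A, only colored roots [ord0] remain, and they may take over any set of uncolored
    roots. The constant coefficients 1 are those of exp(d/dx), which is the shift S. *)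
Lemma total_weight_true n w :
  total_weight true true ok n.+1 w =
  total_weight true true ok n (fun t e =>
    binconv ok (w t.+1) e + binconv (fun=> 1) (fun i => w i e.+1) t).
Proof.
rewrite total_weight_glue //; apply: eq_bigr => s _.
rewrite (bigID (fun x => ~~ x.1.1 && (x.1.2 == None))) /=.
rewrite sum_glue_oroot; congr (_ + _).
rewrite (reindex_onto (fun A => (true, None, A)) snd) /=; last first.
  case=> [[[] p] A] /=; first by rewrite andbT => /andP[/eqP ->].
  by case: p => [?|]; rewrite ?andbF.
rewrite -(sum_subset_ok xpredT (fun i => w i #|eroots s|.+1)).
apply: eq_big => [A|A]; first by rewrite !eqxx !andbT.
by rewrite !andbT => /andP[/eroots_oroots -> _].
Qed.

(** Besides x A, either [ord0] is colored and isolated, or it is uncolored below a colored root;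
    together these cases give y B. *)
Lemma total_weight_false r n w :
  total_weight false r ok n.+1 w =
  total_weight false r ok n (fun t e =>
    binconv ok (w t.+1) e + binconv ok_or_0 (fun j => w t j.+1) e).
Proof.
rewrite total_weight_glue //; apply: eq_bigr => s _.
rewrite (bigID (fun x => ~~ x.1.1 && (x.1.2 == None))) /=.
rewrite sum_glue_oroot; congr (_ + _).
rewrite -(sum_subset_ok ok_or_0 (fun j => w #|oroots s| j.+1)).
(* The parent of ord0 together with its children forms a set of colored roots
   in which the parent is the cmp r-least element; the empty set stands for an
   isolated colored ord0. *)
pose phi (A : {set 'I_n}) : bool * option 'I_n * {set 'I_n} :=
  if [pick v in A | [forall i in A :\ v, cmp r v i]] is Some v
  then (false, Some v, A :\ v) else (true, None, A).
pose psi (x : bool * option 'I_n * {set 'I_n}) :=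
  if x.1.2 is Some v then v |: x.2 else x.2.
rewrite (reindex_onto phi psi) /=.
  apply: eq_big => [A|A].
    rewrite /phi; case: pickP => [v /andP[vA hv]|hA] /=.
      rewrite /psi /= setD1K // eqxx !andbT hv andbT.
      have -> : (A \subset eroots s) =
          (v \in eroots s) && (A :\ v \subset eroots s).
        by rewrite -{1}(setD1K vA) subUset sub1set.
      rewrite [in RHS](cardsD1 v A) vA.
      by case: (v \in _); rewrite ?andbT ?andbF.
    rewrite /psi /= eqxx !andbT.
    case: (eqVneq A set0) => [->|/(cmp_least r)[v vA hv]].
      by rewrite !sub0set cards0.
    by have := hA v; rewrite vA hv.
  rewrite /phi; case: pickP => [v /andP[vA hv]|hA] /=.
    case/andP => /andP[/and3P[AE _ /andP[vE _]] _] _.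
    rewrite oroots_eroots // !add0n; congr (w _ _).
    (* The parent [v] stays a colored root and provides the factor y. *)
    rewrite (cardsD1 v) in_setD vE setD11 /= add1n; congr _.+1.
    apply: eq_card => i; rewrite !inE.
    by case: (eqVneq i v) => [->|]; rewrite ?vA.
  case/andP => /andP[/andP[AO _] _] _; rewrite !add1n !add0n.
  case: (eqVneq A set0) => [->|/(cmp_least r)[v vA hv]].
    by rewrite !setD0.
  by have := hA v; rewrite vA hv.
case=> [[[] p] A] /=.
  rewrite andbT => /andP[/eqP -> /andP[_ /eqP ->]].
  by rewrite /phi /psi /=; case: pickP => // v; rewrite inE.
case: p => [v|] /=; last by rewrite andbF.
rewrite andbT => /and3P[AE _ /andP[vE /forall_inP hv]].
have nvA : v \notin A by apply/negP => /hv; rewrite cmpxx.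
rewrite /phi /psi /=; case: pickP => [u /andP[uA hu]|/(_ v)].
  have -> : u = v.
    apply: (@cmp_least_uniq r _ (v |: A)) => //; first by rewrite !inE eqxx.
    by rewrite setU1K //; apply/forall_inP.
  by rewrite setU1K.
by rewrite setU1K // setU11 /= => /negbT/negP[]; apply/forall_inP.
Qed.

Lemma total_weight0 q r (w : nat -> nat -> nat) :
  total_weight q r ok 0 w = w 0 0.
Proof.
have no (v : 'I_0) : False by case: v.
have E0 (A : {set 'I_0}) : A = set0 by apply/setP; case.
pose s0 : colored_map 0 := ([ffun=> None], set0).
rewrite /total_weight (big_pred1 s0) => [|s].
  by rewrite !(E0 (_ s0)) !cards0.
rewrite (_ : s = s0) /= ?eqxx.
  by apply/locally_niceP; split=> v; case: (no v).
case: s => f c; rewrite (E0 c); congr (_, _).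
by apply/ffunP => v; case: (no v).
Qed.

Lemma eq_total_weight q r n w w' :
  (forall t e, w t e = w' t e) ->
  total_weight q r ok n w = total_weight q r ok n w'.
Proof. by move=> ww'; apply: eq_bigr => s _. Qed.

Lemma total_weightD q r n w w' :
  total_weight q r ok n (fun t e => w t e + w' t e) =
  total_weight q r ok n w + total_weight q r ok n w'.
Proof. exact: big_split. Qed.

(** [r] only decides which element of a set of colored roots is the parent, and the recursion does
    not depend on this choice. *)
Lemma total_weight_false_indep r n w :
  total_weight false r ok n w = total_weight false true ok n w.
Proof.
by elim: n w => [|n IH] w; rewrite ?total_weight0 // !total_weight_false IH.
Qed.

(* S p_n = B p_n. *)
Lemma total_weight_transfer n w :
  total_weight false true ok n (fun t e => binconv (fun=> 1) (w^~ e) t) =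
  total_weight false true ok n (fun t e => binconv ok_or_0 (w t) e).
Proof.
elim: n w => [|n IH] w; first by rewrite !total_weight0 /= !mul1n.
rewrite !total_weight_false.
(* [v] transposes (x + 1) A + y B, according to S (x A + y B) = ((x + 1) A + y B) S. *)
pose v t e := binconv ok (w t.+1) e + (binconv ok (w t) e
                + binconv ok_or_0 (fun j => w t j.+1) e).
rewrite (@eq_total_weight _ _ _ _ (fun t e => binconv (fun=> 1) (v^~ e) t)).
  rewrite IH; apply: eq_total_weight => t e.
  (* Unfolding [binconv] at [j.+1] expresses [B, y] = A, as [ok_or_0 k.+1] is [ok k]. *)
  rewrite /v /= !binconvD binconvC (binconvC _ ok).
  by congr (_ + _); rewrite addnC.
move=> t e; rewrite (@eq_binconv _ _ (fun j =>
  binconv (fun=> 1) (fun i => w i.+1 j) t + binconv (fun=> 1) (w^~ j) t)) //.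
rewrite binconvD (binconv_exchange _ _ (fun i => w i.+1)).
rewrite (binconv_exchange _ _ w).
by rewrite (binconv_exchange _ _ (fun i j => w i j.+1)) -addnA -!binconvD.
Qed.

(** By induction both recursions are applied to the same p_n, where S p_n = B p_n makes them
    agree. *)
Lemma total_weight_true_false n w :
  total_weight true true ok n w = total_weight false true ok n w.
Proof.
elim: n w => [|n IH] w; first by rewrite !total_weight0.
rewrite total_weight_true IH total_weight_false !total_weightD.
by rewrite (total_weight_transfer _ (fun t e => w t e.+1)).
Qed.

Lemma total_weight_indep q r n w : q ==> r ->
  total_weight q r ok n w = total_weight false true ok n w.
Proof.
case: q r => [] [] // _; first exact: total_weight_true_false.
exact: total_weight_false_indep.
Qed.

End Steps.

(** * From patterns to colored forests *)

(** [q] and [r] tell whether the second entry is below the third and below the fourth,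
    respectively. *)
Definition pattern (q r : bool) : 4.-tuple nat :=
  if q then p1234 else if r then p1324 else p1423.

(* If q = true and r = false, the conditions b < c < d and d < b contradict. *)
Lemma pattern_order q r n (a b c d : 'I_n) : q ==> r ->
  [forall i, forall j, (tnth [tuple a; b; c; d] i < tnth [tuple a; b; c; d] j)
     == (tnth (pattern q r) i < tnth (pattern q r) j)]
  = [&& a < b, a < c, c < d, cmp q b c & cmp r b d].
Proof.
move=> qr; apply/forallP/idP => [h|h i].
  have {}h i j (hi : i < 4) (hj : j < 4) :
      (nth a [:: a; b; c; d] i < nth a [:: a; b; c; d] j)
      = (nth 0 (pattern q r) i < nth 0 (pattern q r) j).
    have /forallP/(_ (Ordinal hj))/eqP := h (Ordinal hi).
    by rewrite !(tnth_nth a) !(tnth_nth 0).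
  have := h 0 1 isT isT; have := h 0 2 isT isT; have := h 2 3 isT isT.
  have := h 1 2 isT isT; have := h 2 1 isT isT.
  have := h 1 3 isT isT; have := h 3 1 isT isT.
  by case: q r qr {h} => [] [] //= _; lia.
apply/forallP => j; rewrite !(tnth_nth a) !(tnth_nth 0).
move: h; case: i j => [[|[|[|[|//]]]] hi] [[|[|[|[|//]]]] hj] /=;
  by case: q r qr => [] [] //= _; lia.
Qed.

Lemma is_endpointP q r n (f : parent_map n) d : q ==> r ->
  reflect (exists a b c, [/\ f b = Some a, f c = Some b, f d = Some c
             & [&& a < b, a < c, c < d, cmp q b c & cmp r b d]])
          (is_endpoint (pattern q r) f d).
Proof.
move=> qr; apply: (iffP existsP) => [[v]|[a [b [c [fb fc fd h]]]]].
  case/tupleP: v => a v; case/tupleP: v => b v; case/tupleP: v => c v.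
  case/tupleP: v => d' v; rewrite (tuple0 v) => /andP[/andP[/=]].
  rewrite andbT => /and3P[/eqP fb /eqP fc /eqP fd] h /eqP e.
  have ed : d' = d by rewrite -e (tnth_nth a).
  exists a, b, c; rewrite -ed; split => //; rewrite -pattern_order //.
exists [tuple a; b; c; d]; rewrite /consecutive_instance /= fb fc fd !eqxx /=.
by rewrite pattern_order // h (tnth_nth a) /= !eqxx.
Qed.

Definition children_ok (extra : bool) : pred nat :=
  fun k => if extra then k == 1 else 0 < k.

Definition evens n (f : parent_map n) : {set 'I_n} :=
  [set v | ~~ odd (depth f v)].

Section Depth.
Variables (n : nat) (f : parent_map n).
Hypothesis F : is_forest f.

Lemma evens_parent v u : f v = Some u -> (v \in evens f) = (u \notin evens f).
Proof. by move=> e; rewrite !inE (depth_child F e) negbK. Qed.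

Lemma evens_has_parent v : v \in evens f -> exists u, f v = Some u.
Proof.
case e: (f v) => [u|]; first by exists u.
by rewrite inE depth_root //; apply/eqP.
Qed.

Lemma eroots_evens : #|eroots (f, evens f)| = 0.
Proof.
apply/eqP; rewrite cards_eq0; apply/eqP/setP => v; rewrite in_set /= !in_set.
by case: (f v =P None) => // /eqP e; rewrite depth_root.
Qed.

Lemma oroots_evens : oroots (f, evens f) = [set v | is_root f v].
Proof.
apply/setP => v; rewrite in_set /= !in_set negbK /is_root.
by case: (f v =P None) => // /eqP e; rewrite depth_root.
Qed.

(** An instance of the pattern gathers the local conditions at its last three vertices. Conversely,
    the conditions at a vertex of odd depth are read off from an instance ending at one of its
    children, which exists by niceness. *)
Lemma locally_nice_evens q r extra : q ==> r ->
  locally_nice q r (children_ok extra) (f, evens f) =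
  if extra then extranice (pattern q r) f else nice (pattern q r) f.
Proof.
move=> qr.
have chl v : locally_nice q r (children_ok extra) (f, evens f) ->
    odd (depth f v) -> children_ok extra #|children f v|.
  by case/locally_niceP => h _ _ ov; apply: h; rewrite inE ov.
have wf_nice : locally_nice q r (children_ok extra) (f, evens f) ->
    nice (pattern q r) f.
  move=> W; case/locally_niceP: (W) => _ h2 h3; apply/and3P; split.
  - apply/forallP => v; apply/implyP => /(chl _ W).
    by rewrite /children_ok; case: (extra) => // /eqP ->.
  - apply/forallP => v; apply/implyP => ev; apply/forallP => u.
    by apply/implyP => /eqP /h2 []; rewrite /= inE ev.
  apply/forallP => d; apply/implyP => /andP[ed d4].
  have dE : d \in evens f by rewrite inE.
  have [c fd] := evens_has_parent dE.
  have cE : c \notin evens f by rewrite -(evens_parent fd).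
  case fc: (f c) => [b|]; last first.
    by move: d4; rewrite (depth_child F fd) depth_root //; apply/eqP.
  have bE : b \in evens f by move: cE; rewrite (evens_parent fc) negbK.
  have [a fb] := evens_has_parent bE.
  apply/is_endpointP => //; exists a, b, c; split=> //.
  have := h2 _ _ fd; have := h2 _ _ fc; have := h2 _ _ fb.
  have := h3 _ _ _ fd fc; have := h3 _ _ _ fc fb.
  by rewrite /= dE bE (negbTE cE) => -> -> [_ ->] [_ ->] [_ ->].
have nice_wf : nice (pattern q r) f ->
    (forall v, odd (depth f v) -> children_ok extra #|children f v|) ->
    locally_nice q r (children_ok extra) (f, evens f).
  case/and3P => /forallP n1 /forallP n2 /forallP n3 ch.
  have n4 v u w : v \in evens f -> f v = Some u -> f u = Some w ->
     exists2 a, f w = Some a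
       & [&& a < w, a < u, u < v, cmp q w u & cmp r w v].
    move=> vE fv fu; move: (vE); rewrite inE => ev.
    have wE : w \in evens f.
      by rewrite (evens_parent fv) (evens_parent fu) negbK in vE.
    have [a fw] := evens_has_parent wE.
    have := n3 v; rewrite ev.
    rewrite (depth_child F fv) (depth_child F fu) (depth_child F fw).
    (* The depth of [a] is positive, so that of [v] is at least 4. *)
    have [_ + _] := depth_spec a F; case: (depth f a) => // k _.
    rewrite !ltnS leq0n => /(is_endpointP _ _ qr)[a' [w' [u' []]]].
    rewrite fv => + + [eu]; rewrite -eu fu => + [ew]; rewrite -ew fw => -[<-].
    by exists a.
  have odd_child v : v \notin evens f ->
      exists2 w, f w = Some v & w \in evens f.
    move=> nv; have /implyP := n1 v; rewrite inE negbK in nv.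
    move=> /(_ nv) /card_gt0P[w]; rewrite inE => /eqP fw; exists w => //.
    by rewrite (evens_parent fw) inE negbK.
  apply/locally_niceP; split => /=.
  - by move=> v; rewrite inE negbK; apply: ch.
  - move=> v u fv; split; first exact: evens_parent.
    case: ifP => [|/negbT nv].
      rewrite inE => ev; have /implyP/(_ ev)/forallP/(_ u) := n2 v.
      by rewrite fv eqxx.
    have [w fw wE] := odd_child v nv.
    by have [a _ /and5P[]] := n4 _ _ _ wE fw fv.
  move=> v u w fv fu; case: ifP => [vE|/negbT nv].
    by have [a _ /and5P[]] := n4 _ _ _ vE fv fu.
  have [x fx xE] := odd_child v nv.
  by have [a + /and5P[_ + _ _ _]] := n4 _ _ _ xE fx fv; rewrite fu => -[<-].
case: extra chl wf_nice nice_wf => chl wf_nice nice_wf.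
  apply/idP/andP => [W|[N /forallP h]].
    split; first exact: wf_nice.
    by apply/forallP => v; apply/implyP; apply: chl.
  by apply: nice_wf => // v; apply/implyP.
apply/idP/idP => // N; apply: nice_wf => // v; apply/implyP.
by case/and3P: N => /forallP.
Qed.

End Depth.

(** For an uncolored vertex, passing to the grandparent decreases the label, so induction on the
    label applies; a colored vertex reduces to its parent. *)
Lemma locally_nice_is_forest q r ok n (s : colored_map n) :
  locally_nice q r ok s -> is_forest s.1.
Proof.
move=> /locally_niceP[_ h2 h3].
have odd_ok (m : nat) (v : 'I_n) : v <= m ->
    v \notin s.2 -> exists k, ancestor s.1 k v = None.
  elim/ltn_ind: m v => m IH v vm nv.
  case fv: (s.1 v) => [u|]; last by exists 1; rewrite ancestorS fv.
  case fu: (s.1 u) => [w|]; last by exists 2; rewrite /ancestor /= fv /= fu.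
  have wv := h3 _ _ _ fv fu; rewrite (negbTE nv) in wv.
  have [k hk] : exists k, ancestor s.1 k w = None.
    apply: (IH w _ w) => //; first exact: leq_trans wv vm.
    have [vu _] := h2 _ _ fv; have [uw _] := h2 _ _ fu.
    by rewrite -uw; move: nv; rewrite vu negbK.
  exists k.+2.
  by rewrite ancestorS fv -[LHS]/(ancestor s.1 k.+1 u) ancestorS fu.
apply/is_forestP => v.
case: (boolP (v \in s.2)) => [vE|/(odd_ok v)]; last exact.
case fv: (s.1 v) => [u|]; last by exists 1; rewrite ancestorS fv.
have [k hk] : exists k, ancestor s.1 k u = None.
  by apply: (odd_ok u) => //; have [<-] := h2 _ _ fv.
by exists k.+1; rewrite ancestorS fv.
Qed.

(** Colors alternate along edges and all roots are uncolored, so the color is the parity of the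
    depth. *)
Lemma locally_nice_evens_eq q r ok n (s : colored_map n) :
  locally_nice q r ok s -> #|eroots s| = 0 -> s = (s.1, evens s.1).
Proof.
move=> W /eqP; rewrite cards_eq0 => /eqP e0.
have F := locally_nice_is_forest W; have /locally_niceP[_ h2 _] := W.
case: s {W} e0 F h2 => f c /= e0 F h2; congr (_, _); apply/setP => v.
move: {2}(depth f v) (erefl (depth f v)) => d.
elim: d v => [|d IH] v dv; case fv: (f v) => [u|].
- by have := depth_child F fv; rewrite dv.
- by have := depth_root (introT eqP fv); rewrite dv.
- rewrite (h2 _ _ fv).1 (evens_parent F fv) IH //.
  by have := depth_child F fv; rewrite dv => -[].
have -> : (v \in c) = false by have /setP/(_ v) := e0; rewrite !inE fv.
by rewrite inE depth_root // /is_root fv.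
Qed.

(** * Counting nice forests and trees *)

(** Taking [predT] or [pred1 1] for [P] gives forests or trees. *)
Definition nice_count n (extra : bool) (P : pred nat) (sigma : 4.-tuple nat) :=
  #|[set f : parent_map n | [&& is_forest f, P #|[set v | is_root f v]| &
      if extra then extranice sigma f else nice sigma f]]|.

(** Coloring by parity of depth is a bijection from nice (or extranice) forests onto locally nice
    colored maps without colored roots; the factor [e == 0] selects the latter. *)
Lemma nice_count_total_weight q r extra n (P : pred nat) : q ==> r ->
  nice_count n extra P (pattern q r) =
  total_weight q r (children_ok extra) n (fun t e => P t && (e == 0)).
Proof.
move=> qr; have inj : injective (fun f : parent_map n => (f, evens f)).
  by move=> f g [].
rewrite /nice_count -(card_imset _ inj) /total_weight -sum1_card.
rewrite big_mkcond [RHS]big_mkcond.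
apply: eq_bigr => s _; case: imsetP => [[f]|].
  rewrite inE => /and3P[F Pf N] ->.
  by rewrite locally_nice_evens // N eroots_evens // oroots_evens // Pf.
case: ifP => // W; case: andP => // -[Pt /eqP e0] []; exists s.1; last first.
  exact: (locally_nice_evens_eq W).
have F := locally_nice_is_forest W; have es := locally_nice_evens_eq W e0.
by rewrite inE F -oroots_evens // -locally_nice_evens // -es Pt.
Qed.

Lemma nice_count_pattern q r extra n (P : pred nat) : q ==> r ->
  nice_count n extra P (pattern q r) = nice_count n extra P p1324.
Proof.
move=> qr; rewrite nice_count_total_weight // total_weight_indep //.
by rewrite -[p1324]/(pattern false true) nice_count_total_weight.
Qed.

Theorem theorem6p32 (n : nat) :
  ((#|nice_forests n p1234| = #|nice_forests n p1423| /\
    #|nice_forests n p1423| = #|nice_forests n p1324|) /\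
   (#|nice_trees n p1234| = #|nice_trees n p1423| /\
    #|nice_trees n p1423| = #|nice_trees n p1324|)) /\
  ((#|extranice_forests n p1234| = #|extranice_forests n p1423| /\
    #|extranice_forests n p1423| = #|extranice_forests n p1324|) /\
   (#|extranice_trees n p1234| = #|extranice_trees n p1423| /\
    #|extranice_trees n p1423| = #|extranice_trees n p1324|)).
Proof.
have nf sigma : #|nice_forests n sigma| = nice_count n false predT sigma.
  by apply: eq_card => f; rewrite !in_set.
have nt sigma : #|nice_trees n sigma| = nice_count n false (pred1 1) sigma.
  by apply: eq_card => f; rewrite !in_set /is_tree -andbA.
have xf sigma : #|extranice_forests n sigma| = nice_count n true predT sigma.
  by apply: eq_card => f; rewrite !in_set.
have xt sigma : #|extranice_trees n sigma| = nice_count n true (pred1 1) sigma.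
  by apply: eq_card => f; rewrite !in_set /is_tree -andbA.
pose good sigma := forall extra P,
  nice_count n extra P sigma = nice_count n extra P p1324.
have good1234 : good p1234.
  by move=> extra P; exact: (@nice_count_pattern true true).
have good1423 : good p1423.
  by move=> extra P; exact: (@nice_count_pattern false false).
have good1324 : good p1324.
  by move=> extra P; reflexivity.
have eqs s1 s2 : good s1 -> good s2 ->
    [/\ #|nice_forests n s1| = #|nice_forests n s2|,
        #|nice_trees n s1| = #|nice_trees n s2|,
        #|extranice_forests n s1| = #|extranice_forests n s2|
      & #|extranice_trees n s1| = #|extranice_trees n s2|].
  move=> g1 g2; have e extra P := etrans (g1 extra P) (esym (g2 extra P)).
  split.
  - by rewrite !nf; exact: e.
  - by rewrite !nt; exact: e.
  - by rewrite !xf; exact: e.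
  - by rewrite !xt; exact: e.
have [f1 t1 xf1 xt1] := eqs _ _ good1234 good1423.
have [f2 t2 xf2 xt2] := eqs _ _ good1423 good1324.
exact: (conj (conj (conj f1 f2) (conj t1 t2))
             (conj (conj xf1 xf2) (conj xt1 xt2))).
Qed.
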